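(* The generalised left Fischer cover is canonical. That is: for a sofic shift $X$ let $(G_X,\mathcal{L}_X)$ be its generalised left Fischer cover, let $\mathsf{X}_{G_X}$ be the edge shift of the underlying graph, and let $\pi_X\colon \mathsf{X}_{G_X}\to X$, $\pi_X((e_i)_{i\in\mathbb{Z}})=(\mathcal{L}_X(e_i))_{i\in\mathbb{Z}}$, be the covering map. Whenever $X,Y$ are sofic shifts and $\varphi\colon X\to Y$ is a conjugacy, there exists a unique conjugacy $\psi\colon \mathsf{X}_{G_X}\to\mathsf{X}_{G_Y}$ such that $\pi_Y\circ\psi=\varphi\circ\pi_X$.
   Context: A shift space over a finite alphabet $\mathcal{A}$ is a closed shift-invariant subset $X\subseteq\mathcal{A}^{\mathbb{Z}}$, with shift map $\sigma(x)_i=x_{i+1}$. A conjugacy is a shift-commuting homeomorphism between shift spaces. For $x\in X$ put $x^-=\cdots x_{-2}x_{-1}$ and $x^+=x_0x_1x_2\cdots$; $X^-$ and $X^+$ are the sets of all left-rays and right-rays. The predecessor set of $x^+\in X^+$ is $P_\infty(x^+)=\{y^-\in X^-\mid y^-x^+\in X\}$. A labelled graph $(E,\mathcal{L})$ is a directed graph $E=(E^0,E^1,r,s)$ with a surjective labelling $\mathcal{L}\colon E^1\to\mathcal{A}$. The edge shift of a finite graph $E$ is $\mathsf{X}_E=\{e\in(E^1)^{\mathbb{Z}}\mid r(e_i)=s(e_{i+1})\ \forall i\}$. A labelled graph is a presentation of the shift space $\{(\mathcal{L}(e_i))_i\mid e\in\mathsf{X}_E\}$. A shift space is sofic if it has a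 presentation by a finite labelled graph. The left Krieger cover of a sofic shift $X$ is the (finite) labelled graph $(K,\mathcal{L}_K)$ with $K^0=\{P_\infty(x^+)\mid x^+\in X^+\}$ and an edge labelled $a\in\mathcal{A}$ from $P$ to $P'$ if and only if there is $x^+\in X^+$ with $P=P_\infty(ax^+)$ and $P'=P_\infty(x^+)$. A vertex $P\in K^0$ is indecomposable if $V\subseteq K^0$ and $P=\bigcup_{Q\in V}Q$ imply $P\in V$. For vertices write $P\ge P'$ if there is a (possibly trivial) path in $K$ from $P$ to $P'$. The generalised left Fischer cover of $X$ is the labelled subgraph of $(K,\mathcal{L}_K)$ induced by the vertex set $G^0=\{P\in K^0\mid P\ge P'\text{ for some indecomposable }P'\in K^0\}$. *)

(* Defs.v *)
From HB Require Import structures.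
From Stdlib Require Import Relation_Operators.
From mathcomp Require Import all_boot all_order all_algebra.
From mathcomp Require Import all_classical topology.
From mathcomp Require Import zify.

Set Implicit Arguments.
Unset Strict Implicit.
Unset Printing Implicit Defensive.

Import GRing.Theory.
Local Open Scope classical_set_scope.

(* Alphabets are choice types with the discrete topology, so that the edge set
   of a graph can serve as an alphabet; finiteness is imposed separately. *)
Notation full_shift T := {ptws int -> discrete_topology T}.

Definition shift (T : Type) (x : int -> T) : int -> T := fun i => x (i + 1)%R.

(* Shift-invariance is two-sided: since [shift] is a bijection of the full
   shift, [points_shift] says exactly that the image of [points] is [points]. *)
Record shift_space (T : choiceType) := ShiftSpace {
  points :> set (full_shift T);
  points_closed : closed points;
  points_shift : forall x : full_shift T, points (shift x) <-> points x }.

Section ShiftSpace.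
Context (T : choiceType).

Lemma shift_mem (X : shift_space T) (x : X) : shift (val x) \in points X.
Proof. by apply: mem_set; apply/points_shift; exact: set_valP. Qed.

Definition shift_map (X : shift_space T) (x : X) : X := SigSub (shift_mem x).

Lemma nbhs_coord (x : full_shift T) (i : int) :
  nbhs x [set y : full_shift T | y i = x i].
Proof.
have /(_ x) := @proj_continuous int (fun _ => discrete_topology T) i.
by move=> /(_ [set x i]); apply; exact: discrete_set1.
Qed.

Lemma closed_approx (A : set (full_shift T)) (x : full_shift T) :
  closed A ->
  (forall n : nat, exists y : full_shift T,
    A y /\ forall i : int, (- (n%:Z) <= i < n%:Z)%R -> y i = x i) ->
  A x.
Proof.
move=> clA /choice[y yP].
apply: (@closed_cvg nat _ \oo _ y A clA); first by apply: nearW => n; case: (yP n).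
apply/cvg_sup => i U [/= _ [[V oV <-] Vx]] /filterS; apply.
exists (`|i|.+1)%N => // n /= ni; rewrite /= (yP n).2 //; lia.
Qed.

Lemma points_translate (X : shift_space T) (x : full_shift T) (n : nat) :
  points X (fun i => x (i + n%:Z)%R) <-> points X x.
Proof.
elim: n x => [|n IHn] x.
  by rewrite (_ : (fun i => x (i + 0)%R) = x)//; apply/funext=> i; rewrite addr0.
rewrite -[X in _ <-> X]IHn -[X in _ <-> X]points_shift /shift.
rewrite (_ : (fun i => x (i + n.+1%:Z)%R) = (fun i => x (i + 1 + n%:Z)%R))//.
by apply/funext=> i; congr x; lia.
Qed.

End ShiftSpace.

Definition homeomorphism (S T : topologicalType) (f : S -> T) : Prop :=
  continuous f /\
  exists g : T -> S, [/\ continuous g, cancel f g & cancel g f].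

Definition conjugacy (S T : choiceType) (X : shift_space S) (Y : shift_space T)
    (phi : X -> Y) : Prop :=
  homeomorphism phi /\ forall x, phi (shift_map x) = shift_map (phi x).

(* Surjectivity of the labelling is not a field, because the Krieger cover
   only uses the letters occurring in its shift space; see [sofic]. *)
Record labelled_graph (A : Type) := LabelledGraph {
  vertex : Type;
  edge : choiceType;
  src : edge -> vertex;
  tgt : edge -> vertex;
  label : edge -> A }.

Section LabelledGraph.
Context (A : Type) (G : labelled_graph A).

Definition finite_graph : Prop :=
  finite_set [set: vertex G] /\ finite_set [set: edge G].

Definition edge_shift_set : set (full_shift (edge G)) :=
  [set e | forall i : int, tgt (e i) = src (e (i + 1)%R)].

Lemma edge_shift_closed : closed edge_shift_set.
Proof.
move=> x clx i.
have [e [/= he [ei ei1]]] :=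
  clx _ (filterI (nbhs_coord x i) (nbhs_coord x (i + 1)%R)).
by rewrite -ei -ei1; exact: he.
Qed.

Lemma edge_shift_shift (e : full_shift (edge G)) :
  edge_shift_set (shift e) <-> edge_shift_set e.
Proof.
split=> he i; last exact: he.
by have := he (i - 1)%R; rewrite /shift !subrK.
Qed.

Definition edge_shift : shift_space (edge G) :=
  ShiftSpace edge_shift_closed edge_shift_shift.

Definition label_seq (e : int -> edge G) : int -> A := fun i => label (e i).

Definition reachable : vertex G -> vertex G -> Prop :=
  clos_refl_trans_1n _ (fun u v => exists e : edge G, src e = u /\ tgt e = v).

Section Induced.
Context (W : set (vertex G)).

Definition induced_edge := [set e : edge G | W (src e) /\ W (tgt e)].

Lemma induced_src_mem (e : induced_edge) : src (val e) \in W.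
Proof. by apply: mem_set; case: (set_valP e). Qed.

Lemma induced_tgt_mem (e : induced_edge) : tgt (val e) \in W.
Proof. by apply: mem_set; case: (set_valP e). Qed.

Definition induced_subgraph : labelled_graph A := {|
  vertex := set_type W;
  edge := set_type induced_edge;
  src e := SigSub (induced_src_mem e);
  tgt e := SigSub (induced_tgt_mem e);
  label e := label (val e) |}.

End Induced.
End LabelledGraph.

Arguments edge_shift_set {A} G.

Definition presents (A : choiceType) (G : labelled_graph A)
    (X : shift_space A) : Prop :=
  points X = (@label_seq A G) @` edge_shift_set G.

Definition sofic (A : choiceType) (X : shift_space A) : Prop :=
  exists G : labelled_graph A,
    [/\ finite_graph G, forall a, exists e : edge G, label e = a
      & presents G X].

Section Krieger.
Context (A : choiceType).

(* A left-ray is stored from right to left: y n is the letter at position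
   -(n + 1), which is the integer Negz n. *)
Definition left_ray (x : int -> A) : nat -> A := fun n => x (Negz n).
Definition right_ray (x : int -> A) : nat -> A := fun n => x (Posz n).

Definition glue (y z : nat -> A) : int -> A :=
  fun i => match i with Posz n => z n | Negz n => y n end.

Definition prepend (a : A) (z : nat -> A) : nat -> A :=
  fun n => if n is m.+1 then z m else a.

Context (X : shift_space A).

Definition left_rays : set (nat -> A) := left_ray @` X.
Definition right_rays : set (nat -> A) := right_ray @` X.

Definition predecessor_set (z : nat -> A) : set (nat -> A) :=
  [set y | left_rays y /\ points X (glue y z)].

Definition krieger_vertex : set (set (nat -> A)) :=
  predecessor_set @` right_rays.

Definition krieger_edge : set (krieger_vertex * A * krieger_vertex) :=
  [set e | exists z, [/\ right_rays z,
     val e.1.1 = predecessor_set (prepend e.1.2 z)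
   & val e.2 = predecessor_set z]].

Definition krieger_cover : labelled_graph A := {|
  vertex := set_type krieger_vertex;
  edge := set_type krieger_edge;
  src e := (val e).1.1;
  tgt e := (val e).2;
  label e := (val e).1.2 |}.

Definition indecomposable (P : vertex krieger_cover) : Prop :=
  forall V : set (vertex krieger_cover),
    val P = \bigcup_(Q in V) val Q -> V P.

Definition fischer_vertex : set (vertex krieger_cover) :=
  [set P | exists2 P', indecomposable P' & reachable P P'].

Definition gen_left_fischer_cover : labelled_graph A :=
  induced_subgraph fischer_vertex.

(* The remaining lemmas show that the label sequence of a bi-infinite path
   lies in X, so that the covering map takes values in X. *)
Lemma glue_rays (x : int -> A) : glue (left_ray x) (right_ray x) = x.
Proof. by apply/funext => -[]. Qed.

Lemma predecessor_setE z y : predecessor_set z y <-> points X (glue y z).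
Proof.
by split=> [[]//|yz]; split=> //; exists (glue y z) => //; apply/funext.
Qed.

Lemma predecessor_set_prepend a z y :
  predecessor_set (prepend a z) y <-> predecessor_set z (prepend a y).
Proof.
rewrite !predecessor_setE -points_shift.
rewrite (_ : shift (glue y (prepend a z)) = glue (prepend a y) z)//.
apply/funext => -[n|[|n]]; rewrite /shift //=.
  by rewrite addn1.
by rewrite subn1.
Qed.

Lemma krieger_path_right_ray (e : full_shift (edge krieger_cover)) (k : nat) :
  edge_shift_set krieger_cover e -> forall i : int, exists z,
    [/\ right_rays z, predecessor_set z = val (src (e i))
      & forall j : nat, (j < k)%N -> z j = label (e (i + j%:Z)%R)].
Proof.
move=> he; elim: k => [|k IHk] i.
  by have [z Xz zE] := set_valP (src (e i)); exists z.
have [z [Xz zE zP]] := IHk (i + 1)%R.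
have [u [Xu uS uT]] := set_valP (e i).
have [w [w' Xw' w'E] wE] := set_valP (src (e i)).
have aE : predecessor_set (prepend (label (e i)) z) = val (src (e i)).
  have zu : predecessor_set z = predecessor_set u by rewrite zE -he.
  rewrite [RHS]uS; apply/seteqP; split=> y /predecessor_set_prepend h;
    by apply/predecessor_set_prepend; rewrite ?zu // -zu.
exists (prepend (label (e i)) z); split=> //.
- have : predecessor_set (prepend (label (e i)) z) (left_ray w').
    by rewrite aE -wE predecessor_setE -w'E glue_rays.
  rewrite predecessor_setE => h.
  by exists (glue (left_ray w') (prepend (label (e i)) z)) => //; apply/funext.
- case=> [|j] jk /=; first by rewrite addr0.
  by rewrite zP//; congr (label (e _)); lia.
Qed.

Lemma label_seq_krieger (e : full_shift (edge krieger_cover)) :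
  edge_shift_set krieger_cover e -> points X (label_seq e).
Proof.
move=> he; apply: (closed_approx (@points_closed _ X)) => n.
have [_ [[x Xx <-] _ zP]] := krieger_path_right_ray (n + n) he (- n%:Z)%R.
exists (fun i => x (i + n%:Z)%R); split; first exact/points_translate.
move=> i ni; have [j ij] : exists j : nat, (i + n%:Z)%R = Posz j.
  by exists `|(i + n%:Z)%R|%N; lia.
rewrite ij; have := zP j; rewrite /right_ray => ->; last by lia.
by congr (label (e _)); lia.
Qed.

Lemma covering_map_mem (e : edge_shift gen_left_fischer_cover) :
  label_seq (val e) \in points X.
Proof.
apply: mem_set.
apply: (@label_seq_krieger (fun i => val (val e i))) => i.
exact: (congr1 val (set_valP e i)).
Qed.

Definition covering_map (e : edge_shift gen_left_fischer_cover) : X :=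
  SigSub (covering_map_mem e).

End Krieger.

(* Main.v *)
Require Import Defs.
From Stdlib Require Import Relation_Operators Operators_Properties.
From mathcomp Require Import all_boot all_order all_algebra.
From mathcomp Require Import all_classical topology.
From mathcomp Require Import finmap zify.

(** A bi-infinite path of the left Krieger cover of X, with vertices V_j and
    labels x, is determined by x and by the set S of points u of X that are
    eventually equal to x on the right and satisfy u_(-oo,j) \in V_j for large
    j: these are the labels of the paths that are right-asymptotic to it, and
    V_j consists of the left rays that x_[j,oo) completes to a point of S.
    Hence a conjugacy phi can only be lifted by sending (x, S) to
    (phi x, phi S), which gives uniqueness.  This recipe does define a lift:
    if V_j is the predecessor set of the right ray of z, where z is equal to x
    to the left of a position far beyond j, then the vertices of the image at
    positions before j are predecessor sets of right rays of phi z.  The inverse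
    of phi induces the inverse lift.  The lift preserves the generalised Fischer
    cover because an indecomposable vertex P_oo(z) of the cover of X has the
    form P_oo(z') where phi of z' has, further to the right, an indecomposable
    predecessor set. *)

Set Implicit Arguments.
Unset Strict Implicit.
Unset Printing Implicit Defensive.

Import Order.TTheory GRing.Theory Num.Theory.
Local Open Scope classical_set_scope.

(** * Positions on the line and predecessor sets *)

(** Left rays are read from right to left, as in [left_ray]: [Negz n] is -(n + 1), so position [j]
    itself belongs to [future j]. *)
Definition past (A : Type) (j : int) (x : int -> A) : nat -> A :=
  fun n => x (j + Negz n)%R.
Definition future (A : Type) (j : int) (x : int -> A) : nat -> A :=
  fun n => x (j + Posz n)%R.
Definition splice (A : Type) (j : int) (u x : int -> A) : int -> A :=
  fun i => if (i < j)%R then u i else x i.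

Definition translate (A : Type) (j : int) (x : int -> A) : int -> A :=
  fun i => x (i + j)%R.

Section Splice.
Context (A : Type).
Implicit Types (u x z : int -> A) (i j k : int).

Lemma splice_lt j u x k : (k < j)%R -> splice j u x k = u k.
Proof. by rewrite /splice => ->. Qed.

Lemma splice_ge j u x k : (j <= k)%R -> splice j u x k = x k.
Proof. by rewrite /splice ltNge => ->. Qed.

Lemma eq_splice j u x z : (forall k, (k < j)%R -> z k = u k) ->
  (forall k, (j <= k)%R -> z k = x k) -> splice j u x = z.
Proof.
by move=> zu zx; apply/funext => k; rewrite /splice; case: ltP => [/zu|/zx].
Qed.

Lemma eq_past j u x :
  (forall k, (k < j)%R -> u k = x k) <-> past j u = past j x.
Proof.
split=> [ux|ux k kj]; first by apply/funext => n; apply: ux; lia.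
have := congr1 (fun f => f `|(j - k - 1)%R|%N) ux; rewrite /past /=.
by rewrite (_ : (j + Negz `|(j - k - 1)%R|)%R = k)//; lia.
Qed.

Lemma eq_future j u x :
  (forall k, (j <= k)%R -> u k = x k) <-> future j u = future j x.
Proof.
split=> [ux|ux k kj]; first by apply/funext => n; apply: ux; lia.
have := congr1 (fun f => f `|(k - j)%R|%N) ux; rewrite /future /=.
by rewrite (_ : (j + Posz `|(k - j)%R|)%R = k)//; lia.
Qed.

Lemma past_splice j u x : past j (splice j u x) = past j u.
Proof. by apply/eq_past => k kj; exact: splice_lt. Qed.

Lemma past_surj j x (w : nat -> A) : exists u,
  past j u = w /\ forall k, (j <= k)%R -> u k = x k.
Proof.
exists (fun k => if (k - j)%R is Negz n then w n else x k); split.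
  by apply/funext => n; rewrite /past (_ : (j + Negz n - j)%R = Negz n) //; lia.
move=> k jk; case E : (k - j)%R => [n|n]//; exfalso; lia.
Qed.

End Splice.

(** * Predecessor sets along a point and bi-infinite Krieger paths *)

Section Paths.
Context (A : choiceType) (X : shift_space A).
Implicit Types (u x z : int -> A) (i j k : int) (V : int -> set (nat -> A)).

Lemma points_translatez j x : points X (translate j x) <-> points X x.
Proof.
case: (intP j) => [|n|n].
- rewrite (_ : translate 0 x = x)//.
  by apply/funext => i; rewrite /translate addr0.
- exact: points_translate.
- rewrite -(points_translate _ (translate _ x) n.+1) /translate.
  rewrite (_ : (fun i => _) = x)//.
  by apply/funext => i; rewrite addrK.
Qed.

Definition pred_at j z := predecessor_set X (future j z).

Lemma pred_atE j z u : pred_at j z (past j u) <-> points X (splice j u z).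
Proof.
rewrite /pred_at predecessor_setE -(points_translatez j (splice j u z)).
rewrite (_ : Defs.glue _ _ = translate j (splice j u z))//.
apply/funext => -[n|n]; rewrite /translate /= addrC.
  by rewrite splice_ge//; lia.
by rewrite splice_lt//; lia.
Qed.

Lemma pred_at_self j z : points X z <-> pred_at j z (past j z).
Proof. by rewrite pred_atE (@eq_splice _ j z z z). Qed.

Lemma eq_pred_at j z z' :
  (forall k, (j <= k)%R -> z k = z' k) -> pred_at j z = pred_at j z'.
Proof. by move/eq_future => h; rewrite /pred_at h. Qed.

(** Reduces an inclusion of predecessor sets to bi-infinite points, to which block codes apply:
    every left ray is the past of a sequence that continues as [z]. *)
Lemma pred_at_sub j z (P : set (nat -> A)) :
  (forall u, points X u -> (forall k, (j <= k)%R -> u k = z k) ->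
     P (past j u)) -> pred_at j z `<=` P.
Proof.
move=> h w; have [u [<- uz]] := past_surj j z w.
rewrite pred_atE (@eq_splice _ j u z u)// => Xu; exact: h.
Qed.

(* The words read between [i] and [j] being equal, the two predecessor sets at
   [i] are obtained from those at [j] by the same left extension. *)
Lemma pred_at_back i j z z' : (i <= j)%R ->
  (forall k, (i <= k < j)%R -> z k = z' k) ->
  pred_at j z = pred_at j z' -> pred_at i z = pred_at i z'.
Proof.
move=> ij zz' E; apply/funext => w; apply/propext.
have [u [<- uz]] := past_surj i z w.
rewrite !pred_atE.
have -> : splice i u z' = splice j (splice i u z') z'.
  symmetry; apply: eq_splice => k jk //; rewrite splice_ge//; lia.
rewrite -(pred_atE j z' (splice i u z')) -E pred_atE.
rewrite (@eq_splice _ j _ z (splice i u z))// => k kj.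
  by rewrite /splice; case: ltP => // ki; apply: zz'; lia.
by rewrite splice_ge //; lia.
Qed.

(* [V] and [x] are the vertices and the labels of a bi-infinite path of the
   left Krieger cover. *)
Definition kpath V x := forall j, exists z, [/\ points X z,
  forall k, (k < j)%R -> z k = x k & forall k, (k <= j)%R -> V k = pred_at k z].

Lemma points_approx x :
  (forall j, exists z, points X z /\ forall k, (k < j)%R -> z k = x k) ->
  points X x.
Proof.
move=> h; apply: (closed_approx (@points_closed _ X)) => n.
by have [z [Xz zx]] := h (Posz n); exists z; split => // i /andP[_ /zx].
Qed.

Lemma kpath_points V x : kpath V x -> points X x.
Proof.
by move=> h; apply: points_approx => j; have [z [? ? _]] := h j; exists z.
Qed.

Lemma kpath_splice V x j z : kpath V x -> V j = pred_at j z ->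
  points X (splice j x z) /\
  forall k, (k <= j)%R -> V k = pred_at k (splice j x z).
Proof.
move=> h Vz; have [z' [Xz' z'x Vz']] := h j.
have E : pred_at j z' = pred_at j z by rewrite -Vz Vz'.
split.
  rewrite -pred_atE -E (_ : past j x = past j z'); first exact/pred_at_self.
  by apply/eq_past => k /z'x.
move=> k kj; rewrite Vz'//; apply: (pred_at_back kj).
  by move=> k' ?; rewrite z'x ?splice_lt//; lia.
by rewrite E; apply: eq_pred_at => k' ?; rewrite splice_ge.
Qed.

(** A witness of [kpath] follows [x] only up to a finite position, so the point is obtained as a
    limit: [u] is completed by witnesses for later and later positions. *)
Lemma kpath_extend V x j u : kpath V x -> V j (past j u) ->
  points X (splice j u x).
Proof.
move=> h Vu; apply: points_approx => i.
have [z [Xz zx Vz]] := h (Num.max i j).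
exists (splice j u z); split; first by rewrite -pred_atE -Vz//; lia.
by move=> k ki; rewrite /splice; case: ifP => // _; rewrite zx//; lia.
Qed.

(** This is the set S; by [asympE] the test may be made at any position from which [u] agrees with
    [x]. *)
Definition asymp V x u := exists j,
  (forall k, (j <= k)%R -> u k = x k) /\ V j (past j u).

(** Both memberships say that one and the same sequence, [u] continued by a representative [z] of
    [V j], is a point of [X]. *)
Lemma kpath_past V x i j u : kpath V x -> (i <= j)%R ->
  (forall k, (i <= k)%R -> u k = x k) -> V i (past i u) <-> V j (past j u).
Proof.
move=> h ij ux; have [z [Xz zx Vz]] := h j.
rewrite !Vz// !pred_atE (@eq_splice _ i u z (splice j u z))// => k ik.
  by rewrite splice_lt//; lia.
by rewrite /splice; case: ifP => // kj; rewrite zx// ux.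
Qed.

Lemma asympE V x u j : kpath V x -> (forall k, (j <= k)%R -> u k = x k) ->
  asymp V x u <-> V j (past j u).
Proof.
move=> h ux; split=> [[i [ux' Vu]]|Vu]; last by exists j.
case: (leP i j) => ij; first by apply/(kpath_past h ij ux').
by apply/(kpath_past h (ltW ij) ux).
Qed.

Lemma asymp_points V x u : kpath V x -> asymp V x u -> points X u.
Proof.
move=> h [j [ux Vu]]; have := kpath_extend h Vu.
by rewrite (@eq_splice _ j u x u).
Qed.

Lemma asymp_inj V V' x : kpath V x -> kpath V' x ->
  (forall u, asymp V x u <-> asymp V' x u) -> V = V'.
Proof.
move=> h h' E; apply/funext => j; apply/funext => w; apply/propext.
have [u [<- ux]] := past_surj j x w.
by rewrite -(asympE h ux) -(asympE h' ux).
Qed.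

End Paths.

(** * Transfer of paths along a block code *)

(* [R] is the graph of a conjugacy which, together with its inverse, is given
   by a block code of radius [m]; the relational form is symmetric in [X]
   and [Y]. *)
Record block_graph (A B : choiceType) (X : shift_space A) (Y : shift_space B)
    (m : nat) (R : (int -> A) -> (int -> B) -> Prop) : Prop := BlockGraph {
  graph_domain : forall x y, R x y -> points X x;
  graph_codomain : forall x y, R x y -> points Y y;
  graph_total : forall x, points X x -> exists y, R x y;
  graph_surj : forall y, points Y y -> exists x, R x y;
  graph_local : forall x y x' y' i, R x y -> R x' y' ->
    (forall k, (i - Posz m <= k <= i + Posz m)%R -> x k = x' k) -> y i = y' i;
  graph_local_inv : forall x y x' y' i, R x y -> R x' y' ->
    (forall k, (i - Posz m <= k <= i + Posz m)%R -> y k = y' k) -> x i = x' i }.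

Lemma block_graph_flip (A B : choiceType) (X : shift_space A)
    (Y : shift_space B) (m : nat) (R : (int -> A) -> (int -> B) -> Prop) :
  block_graph X Y m R -> block_graph Y X m (fun y x => R x y).
Proof.
move=> [H1 H2 H3 H4 H5 H6]; split=> //.
- by move=> x y; exact: H2.
- by move=> x y; exact: H1.
- by move=> x y x' y' i r r'; exact: H6.
- by move=> x y x' y' i r r'; exact: H5.
Qed.

Section BlockGraph.
Context (A B : choiceType) (X : shift_space A) (Y : shift_space B) (m : nat).
Context (R : (int -> A) -> (int -> B) -> Prop).
Hypothesis RP : block_graph X Y m R.
Implicit Types (x u z : int -> A) (y v t : int -> B) (i j k l : int).

Lemma graph_fun x y y' : R x y -> R x y' -> y = y'.
Proof. by move=> r r'; apply/funext => i; exact: (graph_local RP r r'). Qed.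

Lemma graph_lt x y x' y' j : R x y -> R x' y' ->
  (forall k, (k < j)%R -> x k = x' k) ->
  forall k, (k < j - Posz m)%R -> y k = y' k.
Proof.
by move=> r r' xx' k kj; apply: (graph_local RP r r') => k' ?; apply: xx'; lia.
Qed.

Lemma graph_ge x y x' y' j : R x y -> R x' y' ->
  (forall k, (j <= k)%R -> x k = x' k) ->
  forall k, (j + Posz m <= k)%R -> y k = y' k.
Proof.
by move=> r r' xx' k kj; apply: (graph_local RP r r') => k' ?; apply: xx'; lia.
Qed.

End BlockGraph.

Section Transfer.
Context (A B : choiceType) (X : shift_space A) (Y : shift_space B) (m : nat).
Context (R : (int -> A) -> (int -> B) -> Prop).
Hypothesis RP : block_graph X Y m R.
Implicit Types (x u z : int -> A) (y v t : int -> B) (i j k l : int).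
Implicit Types (V : int -> set (nat -> A)) (W : int -> set (nat -> B)).

Let RPf := block_graph_flip RP.

(* The path [(W, y)] is the image of the path [(V, x)]: a path of the cover is
   determined by the labels of the paths that are right-asymptotic to it. *)
Definition path_image V x W y :=
  R x y /\ forall u v, R u v -> (asymp V x u <-> asymp W y v).

(** The vertex that an image path must have at [i], read off from the image of [asymp V x] without
    choosing a representative of any [V j]. *)
Definition image_vertex V x y i : set (nat -> B) :=
  [set w | exists u v, [/\ R u v, asymp V x u,
    forall k, (i <= k)%R -> v k = y k & past i v = w]].

(** An exchange of right rays at [j], legitimate because [V j] is the predecessor set of [z] there.
    As [x] and [z] agree before j + 2m, the exchange leaves the image unchanged before j + m, and
    from there on the image is that of the new right ray. The bound i + m <= j makes agreement of
    images from [i] on imply agreement from [j] on. *)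
Lemma image_vertexE V x y z t i j : kpath X V x -> R x y -> R z t ->
  (i + Posz m <= j)%R -> V j = pred_at X j z ->
  (forall k, (k < j + Posz m + Posz m)%R -> z k = x k) ->
  image_vertex V x y i = pred_at Y i t.
Proof.
move=> h rxy rzt ij Vz zx.
have ty k : (k < j + Posz m)%R -> t k = y k.
  by move=> kj; apply: (graph_lt RP rzt rxy zx); lia.
apply/seteqP; split.
  move=> w [u [v [ruv Su vy <-]]].
  have ux k : (j <= k)%R -> u k = x k.
    by move=> jk; apply: (graph_ge RPf ruv rxy vy); lia.
  have := (asympE h ux).1 Su; rewrite Vz pred_atE => Xu'.
  have [v' ruv'] := graph_total RP Xu'.
  have u'u k : (k < j + Posz m + Posz m)%R -> splice j u z k = u k.
    by move=> kj; rewrite /splice; case: ltP => // jk; rewrite zx// ux.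
  have v'v k : (k < j + Posz m)%R -> v' k = v k.
    by move=> kj; apply: (graph_lt RP ruv' ruv u'u); lia.
  have v't k : (j + Posz m <= k)%R -> v' k = t k.
    move=> jk; apply: (graph_ge RP ruv' rzt _ jk) => k' ?.
    by rewrite splice_ge.
  apply/pred_atE; rewrite (@eq_splice _ i v t v').
  - exact: (graph_codomain RP ruv').
  - by move=> k ki; rewrite v'v//; lia.
  - move=> k ik; case: (ltP k (j + Posz m)%R) => kj; last exact: v't.
    by rewrite v'v// vy// ty.
apply: pred_at_sub => v Yv vt.
have [u ruv] := graph_surj RP Yv.
have uz k : (j <= k)%R -> u k = z k.
  by move=> jk; apply: (graph_ge RPf ruv rzt vt); lia.
have Vu : V j (past j u).
  rewrite Vz pred_atE (@eq_splice _ j u z u)//; exact: (graph_domain RP ruv).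
have Xu' := kpath_extend h Vu.
have [v' ruv'] := graph_total RP Xu'.
have u'u k : (k < j + Posz m + Posz m)%R -> splice j u x k = u k.
  by move=> kj; rewrite /splice; case: ltP => // jk; rewrite uz// zx.
have v'v k : (k < j + Posz m)%R -> v' k = v k.
  by move=> kj; apply: (graph_lt RP ruv' ruv u'u); lia.
exists (splice j u x), v'; split=> //.
- exists j; split; first exact: splice_ge.
  by rewrite past_splice.
- move=> k ik; case: (ltP k (j + Posz m)%R) => kj.
    by rewrite v'v// vt// ty.
  apply: (graph_ge RP ruv' rxy _ kj) => k' ?; exact: splice_ge.
- by apply/eq_past => k ki; apply: v'v; lia.
Qed.

Lemma image_vertex_kpath V x y : kpath X V x -> R x y ->
  kpath Y (image_vertex V x y) y.
Proof.
move=> h rxy i.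
(* At k <= i, [image_vertexE] is used with j = k + m and needs agreement before k + 3m. *)
have [z [Xz zx Vz]] := h (i + Posz m + Posz m + Posz m)%R.
have [t rzt] := graph_total RP Xz.
exists t; split.
- exact: (graph_codomain RP rzt).
- by move=> k ki; apply: (graph_lt RP rzt rxy zx); lia.
- move=> k ki; apply: (@image_vertexE V x y z t k (k + Posz m)%R) => //.
    by apply: Vz; lia.
  by move=> k' ?; apply: zx; lia.
Qed.

Lemma image_vertex_image V x y : kpath X V x -> R x y ->
  path_image V x (image_vertex V x y) y.
Proof.
move=> h rxy; split=> // u v ruv; split.
  move=> Su; have [j [ux Vu]] := Su.
  have vy := graph_ge RP ruv rxy ux.
  by exists (j + Posz m)%R; split=> //; exists u, v.
move=> [i [vy [u' [v' [ruv' Su' v'y v'v]]]]].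
(* A past and a right tail determine a sequence, so the witness [v'] is [v] itself. *)
suff vv' : v = v' by rewrite (graph_fun RPf ruv (y' := u')) // vv'.
apply/funext => k; case: (ltP k i) => ki; last by rewrite vy// v'y.
by symmetry; exact: (eq_past i v' v).2.
Qed.

Lemma path_image_vertex V x W y : kpath X V x -> kpath Y W y ->
  path_image V x W y -> W = image_vertex V x y.
Proof.
move=> h hW [rxy SW]; have [_ SW'] := image_vertex_image h rxy.
apply: (asymp_inj hW (image_vertex_kpath h rxy)) => v.
split=> Sv.
  have [u ruv] := graph_surj RP (asymp_points hW Sv).
  by apply/(SW' _ _ ruv)/(SW _ _ ruv).
have [u ruv] := graph_surj RP (asymp_points (image_vertex_kpath h rxy) Sv).
by apply/(SW _ _ ruv)/(SW' _ _ ruv).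
Qed.

(** This makes the lift a block code. A representative [z] of the first path, with its part before i
    + m replaced by [x'], represents the second path as well; the two points agree from i - m on, so
    their images agree from [i] on. *)
Lemma image_vertex_local V x y V' x' y' i :
  kpath X V x -> kpath X V' x' -> R x y -> R x' y' ->
  V (i + Posz m)%R = V' (i + Posz m)%R ->
  (forall k, (i - Posz m <= k <= i + Posz m + Posz m + Posz m)%R ->
     x k = x' k) ->
  image_vertex V x y i = image_vertex V' x' y' i.
Proof.
move=> h h' rxy rxy' VV' xx'.
have [z [Xz zx Vz]] := h (i + Posz m + Posz m + Posz m)%R.
have Vz' : V' (i + Posz m)%R = pred_at X (i + Posz m) z.
  by rewrite -VV' Vz//; lia.
have [Xz' _] := kpath_splice h' Vz'.
have [t rzt] := graph_total RP Xz.
have [t' rzt'] := graph_total RP Xz'.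
rewrite (@image_vertexE V x y z t i (i + Posz m)%R)//; last by rewrite VV'.
rewrite (image_vertexE (j := (i + Posz m)%R) h' rxy' rzt')//; first last.
- by move=> k ki; rewrite /splice; case: ltP => // ik; rewrite zx// xx'//; lia.
- by rewrite Vz'; apply: eq_pred_at => k ik; rewrite splice_ge.
apply: eq_pred_at => k ik.
apply: (graph_ge RP rzt rzt' (j := (i - Posz m)%R)); last by lia.
move=> k' ?; rewrite /splice; case: ltP => // ?.
by rewrite zx ?xx'//; lia.
Qed.

End Transfer.

(** * Vertices and edges of the Krieger cover *)

Section Cover.
Context (A : choiceType) (X : shift_space A).
Implicit Types (u x z : int -> A) (i j k l : int) (V : int -> set (nat -> A)).
Implicit Types (P Q : vertex (krieger_cover X)).

Lemma vertex_inj P Q : val P = val Q -> P = Q.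
Proof. exact: val_inj. Qed.

Lemma right_rays_future j z : points X z -> right_rays X (future j z).
Proof.
move=> Xz; exists (translate j z); first exact/points_translatez.
by apply/funext => n; rewrite /translate /right_ray /future addrC.
Qed.

Lemma right_rays_ex j (r : nat -> A) : right_rays X r ->
  exists2 z, points X z & future j z = r.
Proof.
move=> [x Xx <-]; exists (translate (- j) x); first exact/points_translatez.
apply/funext => n; rewrite /translate /future /right_ray.
by congr x; lia.
Qed.

Lemma vertex_pred_at P j : exists2 z, points X z & val P = pred_at X j z.
Proof.
have [r /(right_rays_ex j)[z Xz <-] <-] := set_valP P.
by exists z.
Qed.

Lemma pred_at_vertex j z : points X z -> exists P, val P = pred_at X j z.
Proof.
move=> Xz; have h : pred_at X j z \in krieger_vertex X.
  apply: mem_set; exists (future j z) => //; exact: right_rays_future.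
by exists (SigSub h).
Qed.

Lemma future_prepend j z : future j z = prepend (z j) (future (j + 1) z).
Proof.
apply/funext => -[|n]; rewrite /future /prepend; first by rewrite addr0.
by congr z; lia.
Qed.

(** An edge supplies only a right ray; a left ray taken from the source, which is nonempty,
    completes it to a point of [X]. *)
Lemma edge_pred_at (e : edge (krieger_cover X)) j : exists z,
  [/\ points X z, val (src e) = pred_at X j z,
      val (tgt e) = pred_at X (j + 1) z & label e = z j].
Proof.
have [r [Xr sE tE]] := set_valP e.
have [w Xw wE] := vertex_pred_at (src e) j.
have := (pred_at_self X j w).1 Xw; rewrite -wE [val (src e)]sE.
have [z zj] : exists z, future j z = prepend (label e) r.
  exists (translate (- j) (Defs.glue r (prepend (label e) r))).
  apply/funext => n; rewrite /translate /future.
  by rewrite (_ : (j + Posz n - j)%R = Posz n)//; lia.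
have zj1 : z j = label e.
  by have := congr1 (fun f => f 0%N) zj; rewrite /future /prepend addr0.
have zr : future (j + 1) z = r.
  apply/funext => n; have := congr1 (fun f => f n.+1) zj.
  by rewrite future_prepend.
rewrite -zj => /pred_atE Xz; exists (splice j w z); split=> //.
- by apply: eq_pred_at => k jk; rewrite splice_ge.
- apply: (etrans tE); rewrite -zr; apply: eq_pred_at => k jk.
  by rewrite splice_ge//; lia.
- by rewrite splice_ge.
Qed.

Lemma pred_at_edge z j P Q : points X z ->
  val P = pred_at X j z -> val Q = pred_at X (j + 1) z ->
  exists e : edge (krieger_cover X), [/\ src e = P, tgt e = Q & label e = z j].
Proof.
move=> Xz PE QE.
have h : krieger_edge (P, z j, Q).
  exists (future (j + 1) z); split=> //; first exact: right_rays_future.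
  by rewrite -future_prepend.
by exists (SigSub (mem_set h)).
Qed.

Lemma krieger_edge_inj (e e' : edge (krieger_cover X)) :
  src e = src e' -> tgt e = tgt e' -> label e = label e' -> e = e'.
Proof.
move=> s t a; apply: val_inj; move: s t a => /=.
by case: (val e) => [[p a] q]; case: (val e') => [[p' a'] q'] /= -> -> ->.
Qed.

Lemma reachable_pred_at z j k P Q : points X z -> (j <= k)%R ->
  val P = pred_at X j z -> val Q = pred_at X k z -> reachable P Q.
Proof.
move=> Xz jk; have [n ->] : exists n : nat, k = (j + Posz n)%R.
  by exists `|(k - j)%R|%N; lia.
elim: n {k jk} j P => [|n IHn] j P PE.
  rewrite addr0 -PE => /vertex_inj ->; exact: rt1n_refl.
rewrite (_ : (j + n.+1)%R = (j + 1 + n)%R); last by lia.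
have [P1 P1E] := pred_at_vertex (j + 1) Xz.
move=> /(IHn _ _ P1E); apply: Relation_Operators.rt1n_trans.
by have [e [? ? _]] := pred_at_edge Xz PE P1E; exists e.
Qed.

(** The path is followed edge by edge, each time replacing the right tail by one that carries the
    edge. The predecessor set at [j] survives by [pred_at_back]. *)
Lemma reachable_point P Q z j : reachable P Q -> points X z ->
  val P = pred_at X j z -> exists z' l, [/\ points X z',
    forall k, (k < j)%R -> z' k = z k, (j <= l)%R,
    pred_at X j z' = pred_at X j z & val Q = pred_at X l z'].
Proof.
move=> PQ; elim: PQ z j => [P1|P1 P2 P3 [e [<- <-]] _ IH] z j Xz PE.
  by exists z, j.
have [z0 [Xz0 sE tE _]] := edge_pred_at e j.
have Xz1 : points X (splice j z z0).
  by rewrite -pred_atE -sE PE; apply/pred_at_self.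
have [||z' [l [Xz' z'z jl z'E QE]]] := IH (splice j z z0) (j + 1)%R => //.
  by rewrite tE; apply: eq_pred_at => k ?; rewrite splice_ge//; lia.
exists z', l; split=> //; [|by lia|].
  by move=> k kj; rewrite z'z ?splice_lt//; lia.
rewrite -PE sE (@pred_at_back _ X j (j + 1)%R z' (splice j z z0))//.
- by apply: eq_pred_at => k jk; rewrite splice_ge.
- by lia.
- by move=> k ?; apply: z'z; lia.
Qed.

(** A predecessor set depends only on the set of vertices of the presentation at which paths
    labelled by the right ray start; [F D] collects the labels of the left-infinite parts of paths
    that arrive in [D]. *)
Lemma finite_krieger_vertex : sofic X -> finite_set (krieger_vertex X).
Proof.
move=> [G [[finG _] _ GX]].
have [n /pcard_leP[g]] := (finite_set_leP _).1 finG.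
have gn h : (g h < n)%N by exact: (@funS _ _ _ _ g h).
pose F (D : {set 'I_n}) : set (nat -> A) := [set y | exists2 e : int -> edge G,
  edge_shift_set G e & Ordinal (gn (src (e 0%R))) \in D /\
    (forall k : nat, y k = label (e (Negz k)))].
apply: (@sub_finite_set _ _ (F @` setT)); last first.
  by apply: finite_image; exact: finite_finset.
move=> _ [r Xr <-].
exists (finset (fun d : 'I_n => `[< exists2 e : int -> edge G,
  edge_shift_set G e & Ordinal (gn (src (e 0%R))) = d /\
    forall k : nat, r k = label (e (Posz k)) >])) => //.
apply/seteqP; split=> y.
  move=> [e He []]; rewrite finset.in_set.
  move=> /asboolP[e' He' [/(congr1 val)/= ge re']] ye.
  have {}ge : src (e' 0%R) = src (e 0%R).
    by apply: (@inj _ _ _ g) => //; exact: in_setT.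
  apply/predecessor_setE; rewrite GX.
  exists (splice 0 e e'); last first.
    apply/funext => -[k|k] /=; rewrite /label_seq.
      by rewrite splice_ge// re'.
    by rewrite splice_lt// ye.
  move=> i; case: (ltP i (-1)%R) => i1.
    by rewrite !splice_lt ?He//; lia.
  case: (eqVneq i (-1)%R) => [->|i2].
    by rewrite splice_lt// splice_ge// addNr ge He.
  by rewrite !splice_ge ?He'//; lia.
move=> /predecessor_setE; rewrite GX => -[e He ey].
exists e => //; split.
  rewrite finset.in_set; apply/asboolP; exists e => //; split=> // k.
  exact: (congr1 (fun f => f (Posz k)) (esym ey)).
by move=> k; exact: (congr1 (fun f => f (Negz k)) (esym ey)).
Qed.

(** Induction on the number of vertices contained in [P]: a decomposable [P] is a union of vertices
    other than [P], hence strictly smaller, and one of them contains [y]. *)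
Lemma indecomposable_below P y : finite_set (krieger_vertex X) -> val P y ->
  exists Q, [/\ indecomposable Q, val Q `<=` val P & val Q y].
Proof.
move=> fin.
pose below P' := krieger_vertex X `&` [set S | S `<=` val P'].
have finS P' : finite_set (below P').
  exact: finite_setIl.
have [n] := ubnP (#|` fset_set (below P)|%fset).
elim: n P => // n IHn P; rewrite ltnS => Pn Py.
have [iP|] := pselect (indecomposable P); first by exists P; split.
move=> /existsNP[D /not_implyP[PD nDP]].
move: Py; rewrite PD => -[Q DQ Qy].
have QP : val Q `<=` val P by rewrite PD => w Qw; exists Q.
have QnP : val Q <> val P by move=> /vertex_inj QP'; rewrite QP' in DQ.
have [|Q' [iQ' Q'Q Q'y]] := IHn Q _ Qy; last first.
  by exists Q'; split=> //; rewrite -PD; exact: subset_trans QP.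
apply: leq_trans Pn; apply: fproper_ltn_card.
apply/andP; split.
  apply/fsubsetP => S; rewrite !in_fset_set// => /set_mem[KS SQ].
  by apply: mem_set; split=> //; exact: subset_trans QP.
apply/negP => /fsubsetP/(_ (val P)); rewrite !in_fset_set//.
have /mem_set-> : below P (val P) by split=> //; exact: set_valP.
by move=> /(_ isT)/set_mem[_ PQ]; apply: QnP; exact/seteqP.
Qed.

End Cover.

(** * The generalised Fischer cover *)

Section Fischer.
Context (A : choiceType) (X : shift_space A).
Implicit Types (u x z : int -> A) (i j k l : int) (V : int -> set (nat -> A)).
Implicit Types (P Q : vertex (krieger_cover X)).

Lemma kpath_self V x j : kpath X V x -> V j (past j x).
Proof.
move=> h; have [z [Xz zx ->//]] := h j.
by rewrite -(eq_past j z x).1//; apply/pred_at_self.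
Qed.

(** A representative of the vertex at [j], preceded by the labels of the path, represents all
    earlier vertices, by induction to the left. *)
Lemma kpath_label_seq (e : int -> edge (krieger_cover X)) :
  edge_shift_set (krieger_cover X) e ->
  kpath X (fun j => val (src (e j))) (label_seq e).
Proof.
move=> he j; have [z Xz zE] := vertex_pred_at (src (e j)) j.
pose s := splice j (label_seq e) z.
have Vs n : val (src (e (j - Posz n)%R)) = pred_at X (j - Posz n)%R s.
  elim: n => [|n IHn].
    by rewrite subr0 zE; apply: eq_pred_at => k jk; rewrite /s splice_ge.
  have [z0 [Xz0 -> tE aE]] :=
    edge_pred_at (e (j - Posz n.+1)%R) (j - Posz n.+1)%R.
  apply: (@pred_at_back _ _ _ (j - Posz n.+1 + 1)%R); first by lia.
    move=> k kj; have -> : k = (j - Posz n.+1)%R by lia.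
    by rewrite -aE /s splice_lt//; lia.
  by rewrite -tE he (_ : (j - Posz n.+1 + 1)%R = (j - Posz n)%R)//; lia.
have {}Vs k : (k <= j)%R -> val (src (e k)) = pred_at X k s.
  move=> kj; have := Vs (`|(j - k)%R|%N).
  by rewrite (_ : (j - Posz `|(j - k)%R|)%R = k)//; lia.
exists s; split=> // [|k kj]; last by rewrite /s splice_lt.
apply: (closed_approx (@points_closed _ X)) => n.
(* Below [j] the vertex is known to be a predecessor set of [s]; below -n the new left ray does not
   disturb the window. *)
pose i := Num.min j (- Posz n)%R.
have [w Xw wE] := vertex_pred_at (src (e i)) i.
exists (splice i w s); split; last by move=> k kn; rewrite splice_ge//; lia.
rewrite -pred_atE -Vs ?wE; last by lia.
exact/pred_at_self.
Qed.

Section Asymp.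
Context V x (h : kpath X V x).

(** For [u] in [asymp V x], these are the vertices of the path labelled [u] that is right-asymptotic
    to the given one. *)
Definition asymp_vertex u j : set (nat -> A) := [set w | exists v,
  [/\ past j v = w, forall k, (j <= k)%R -> v k = u k & asymp V x v]].

Lemma asymp_vertex_eq u j : (forall k, (j <= k)%R -> u k = x k) ->
  asymp_vertex u j = V j.
Proof.
move=> ux; apply/seteqP; split=> [w [v [<- vu Sv]]|w Vw].
  have vx k : (j <= k)%R -> v k = x k by move=> jk; rewrite vu ?ux.
  exact: (asympE h vx).1.
have [v [vw vx]] := past_surj j x w.
exists v; split=> //; first by move=> k jk; rewrite vx ?ux.
by apply/(asympE h vx); rewrite vw.
Qed.

(** For k <= l both memberships reduce to one in [V] at the maximum of [l] and [j], beyond which [z]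
    takes over from [u]. *)
Lemma asymp_kpath_ex u l : asymp V x u -> exists z, [/\ points X z,
  forall k, (k < l)%R -> z k = u k &
  forall k, (k <= l)%R -> asymp_vertex u k = pred_at X k z].
Proof.
move=> [j [ux Vu]]; have [z [Xz zx Vz]] := h (Num.max l j).
exists (splice j u z).
have su k : (k < Num.max l j)%R -> splice j u z k = u k.
  by move=> ?; rewrite /splice; case: ltP => // ?; rewrite zx ?ux.
split; first by rewrite -pred_atE -Vz//; lia.
  by move=> k kl; apply: su; lia.
move=> k kl.
have E v : (forall i, (k <= i)%R -> v i = u i) ->
    asymp V x v <-> pred_at X k (splice j u z) (past k v).
  move=> vu; rewrite pred_atE (@asympE _ _ _ _ _ (Num.max l j) h); last first.
    by move=> i ?; rewrite vu ?ux//; lia.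
  rewrite Vz// pred_atE; have -> // : splice (Num.max l j) v z =
    splice k v (splice j u z).
  apply: eq_splice => i ?.
    by rewrite {1}/splice; case: ltP => // ?; rewrite su ?vu.
  by rewrite !splice_ge//; lia.
apply/seteqP; split; first by move=> w [v [<- vu /(E _ vu)]].
move=> w; have [v [<- vu]] := past_surj k u w.
by move=> /(E _ vu) Sv; exists v.
Qed.

Lemma asymp_vertex_kpath u : asymp V x u -> kpath X (asymp_vertex u) u.
Proof. by move=> Su l; exact: asymp_kpath_ex. Qed.

End Asymp.

Lemma fischer_vertex_reachable P Q : reachable P Q ->
  fischer_vertex Q -> fischer_vertex P.
Proof.
move=> PQ [P' iP' QP']; exists P' => //.
by apply: clos_rt_rt1n; apply: rt_trans; apply: clos_rt1n_rt; eassumption.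
Qed.

Lemma kpath_vertex V x j : kpath X V x ->
  exists P, val P = V j.
Proof. by move=> h; have [z [Xz _ ->//]] := h j; exact: pred_at_vertex. Qed.

Definition fischer_path V x := kpath X V x /\
  forall j P, val P = V j -> fischer_vertex P.

Lemma kpath_reachable V x i j P Q : kpath X V x -> (i <= j)%R ->
  val P = V i -> val Q = V j -> reachable P Q.
Proof.
move=> h ij; have [z [Xz _ Vz]] := h j.
by rewrite !Vz//; exact: reachable_pred_at.
Qed.

(** The asymptotic path eventually runs into vertices of the given one, and Fischer vertices are
    closed under going backwards. *)
Lemma asymp_vertex_fischer_path V x u : fischer_path V x -> asymp V x u ->
  fischer_path (asymp_vertex V x u) u.
Proof.
move=> [h Vf] Su; have h' := asymp_vertex_kpath h Su.
split=> // i P PE; have [j [ux _]] := Su.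
have Vj : asymp_vertex V x u (Num.max i j) = V (Num.max i j).
  by apply: (asymp_vertex_eq h) => k ?; apply: ux; lia.
have [Q QE] := kpath_vertex (Num.max i j) h.
have PQ : reachable P Q.
  apply: (kpath_reachable (j := Num.max i j) h' _ PE); first by lia.
  by rewrite Vj.
exact: fischer_vertex_reachable PQ (Vf _ _ QE).
Qed.

Definition path_vertex (e : edge_shift (gen_left_fischer_cover X)) j :=
  val (val (src (val e j))).
Definition path_label (e : edge_shift (gen_left_fischer_cover X)) :=
  label_seq (val e).

Lemma path_tgt (e : edge_shift (gen_left_fischer_cover X)) j :
  tgt (val e j) = src (val e (j + 1)%R).
Proof. exact: (set_valP e). Qed.

Lemma path_fischer_path e : fischer_path (path_vertex e) (path_label e).
Proof.
split.
  apply: (@kpath_label_seq (fun i => val (val e i))) => i.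
  exact: (congr1 val (path_tgt e i)).
by move=> j P /vertex_inj ->; exact: set_valP (src (val e j)).
Qed.

Lemma path_ex V x : fischer_path V x ->
  exists e, path_vertex e = V /\ path_label e = x.
Proof.
move=> [h Vf].
have /choice[f fE] j : exists e : edge (krieger_cover X),
    [/\ val (src e) = V j, val (tgt e) = V (j + 1)%R & label e = x j].
  have [z [Xz zx Vz]] := h (j + 1)%R.
  have [P PE] := pred_at_vertex j Xz.
  have [Q QE] := pred_at_vertex (j + 1)%R Xz.
  have [e [sE tE aE]] := pred_at_edge Xz PE QE.
  by exists e; rewrite sE tE aE PE QE zx ?Vz//; lia.
have fI j : f j \in induced_edge (@fischer_vertex A X).
  by apply: mem_set; have [sE tE _] := fE j; split; apply: Vf; eassumption.
pose g j : edge (gen_left_fischer_cover X) := SigSub (fI j).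
have gS : edge_shift_set (gen_left_fischer_cover X) g.
  move=> j; do 2!apply: val_inj.
  by have [_ -> _] := fE j; have [<- _ _] := fE (j + 1)%R.
exists (SigSub (mem_set gS)); split; apply/funext => j.
  by have [<- _ _] := fE j.
by have [_ _ <-] := fE j.
Qed.

Lemma path_local (e f : edge_shift (gen_left_fischer_cover X)) j :
  path_vertex e j = path_vertex f j ->
  path_vertex e (j + 1)%R = path_vertex f (j + 1)%R ->
  path_label e j = path_label f j -> val e j = val f j.
Proof.
move=> s t a; apply: val_inj; apply: krieger_edge_inj => //.
  exact: vertex_inj.
by apply: vertex_inj; have := t; rewrite /path_vertex -!path_tgt.
Qed.

End Fischer.

(** * Preservation of the generalised Fischer cover *)

Section FischerTransfer.
Context (A B : choiceType) (X : shift_space A) (Y : shift_space B) (m : nat).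
Context (R : (int -> A) -> (int -> B) -> Prop).
Hypothesis RP : block_graph X Y m R.
Hypothesis finY : finite_set (krieger_vertex Y).
Implicit Types (x u z : int -> A) (y v t : int -> B) (i j k l : int).

Let RPf := block_graph_flip RP.

(* Decompose the predecessor set of the image of each [v z], [v] in [P], into
   indecomposable sets, far to the right of [l], and pull the pieces back to
   [X]; this writes [P] as a union, hence [P] is one of the pieces. *)
Lemma indecomposable_image l z (P : vertex (krieger_cover X)) :
  points X z -> val P = pred_at X l z -> indecomposable P ->
  exists z' t' q (Q : vertex (krieger_cover Y)),
    [/\ points X z' /\ R z' t', forall k, (k < l)%R -> z' k = z k,
        pred_at X l z' = pred_at X l z, (l <= q)%R
      & val Q = pred_at Y q t' /\ indecomposable Q].
Proof.
(* A change of the image from l + 3m on leaves the preimage unchanged before l + 2m, and images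
   agreeing from l + m on have preimages agreeing from l + 2m on: the two ranges meet. *)
move=> Xz PE iP; pose q := (l + Posz m + Posz m + Posz m)%R.
pose D := [set P' : vertex (krieger_cover X) | val P' `<=` val P /\
  exists z' t' (Q : vertex (krieger_cover Y)),
    [/\ R z' t', val P' = pred_at X l z', val Q = pred_at Y q t'
      & indecomposable Q]].
suff PD : val P = \bigcup_(Q in D) val Q.
  have [_ [z' [t' [Q [r' P'E QE iQ]]]]] := iP _ PD.
  have Xs : points X (splice l z z').
    by rewrite -pred_atE -P'E PE; exact/pred_at_self.
  have [t rs] := graph_total RP Xs.
  exists (splice l z z'), t, q, Q; split=> //.
  - by move=> k kl; rewrite splice_lt.
  - by rewrite -PE P'E; apply: eq_pred_at => k lk; rewrite splice_ge.
  - by rewrite /q; lia.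
  - split=> //; rewrite QE; apply: eq_pred_at => k qk.
    apply: (graph_ge RP r' rs (j := l)); last by rewrite /q in qk; lia.
    by move=> k' ?; rewrite splice_ge.
apply/seteqP; split; last by move=> w [P' [P'P _]]; exact: P'P.
rewrite [X in X `<=` _]PE; apply: pred_at_sub => v Xv vz.
have [s rvs] := graph_total RP Xv.
have Ys := graph_codomain RP rvs.
have [S SE] := pred_at_vertex q Ys.
have Ss : val S (past q s) by rewrite SE; exact/pred_at_self.
(* [Q] is an indecomposable piece that contains the past of [s], so a right ray representing [Q] may
   follow that past; [v'] is the preimage of the result. *)
have [Q [iQ QS Qs]] := indecomposable_below finY Ss.
have [y' Yy' QE] := vertex_pred_at Q q.
move: Qs; rewrite QE pred_atE => Yr.
have [v' r'] := graph_surj RP Yr.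
have v'v k : (k < l + Posz m + Posz m)%R -> v' k = v k.
  move=> kl; apply: (graph_lt RPf r' rvs (j := q)); last by rewrite /q; lia.
  by move=> k' ?; rewrite splice_lt.
have Xv' := graph_domain RP r'.
have [P' P'E] := pred_at_vertex l Xv'.
exists P'; last first.
  rewrite P'E -(eq_past l v' v).1; first exact/pred_at_self.
  by move=> k ?; apply: v'v; lia.
split; last first.
  exists v', (splice q s y'), Q; split=> //; rewrite QE.
  by apply: eq_pred_at => k ?; rewrite splice_ge.
(* The piece lies in [P]: the image [d] of [c] has its past in [Q], hence in [S], so the right ray
   of [s] can be restored at [q]; the preimage [c'] joins the past of [c] to [z]. *)
rewrite P'E; apply: pred_at_sub => c Xc cv'.
have [d rcd] := graph_total RP Xc.
have dr := graph_ge RP rcd r' cv'.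
have : val Q (past q d).
  rewrite QE pred_atE (@eq_splice _ q d y' d)//.
    exact: (graph_codomain RP rcd).
  by move=> k qk; rewrite dr ?splice_ge//; rewrite /q in qk; lia.
move=> /QS; rewrite SE pred_atE => Yd'.
have [c' rcd'] := graph_surj RP Yd'.
have c'c k : (k < l + Posz m + Posz m)%R -> c' k = c k.
  move=> kl; apply: (graph_lt RPf rcd' rcd (j := q)); last by rewrite /q; lia.
  by move=> k' ?; rewrite splice_lt.
have d's k : (l + Posz m <= k)%R -> splice q d s k = s k.
  by move=> lk; rewrite /splice; case: ltP => // kq; rewrite dr// splice_lt.
have c'z k : (l <= k)%R -> c' k = z k.
  move=> lk; rewrite -vz//.
  case: (ltP k (l + Posz m + Posz m)%R) => kl.
    by rewrite c'c// cv'// v'v.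
  exact: (graph_ge RPf rcd' rvs d's).
rewrite PE pred_atE (@eq_splice _ l c z c').
- exact: (graph_domain RP rcd').
- by move=> k ?; apply: c'c; lia.
- exact: c'z.
Qed.

(** The representative of [V l] is changed only from [l] on, first to pass through an indecomposable
    vertex and then to have an image that does. With l = i + 3m its image still represents the image
    vertex at [i]. *)
Lemma image_vertex_fischer_path V x y : fischer_path X V x -> R x y ->
  fischer_path Y (image_vertex R V x y) y.
Proof.
move=> [h Vf] rxy; split; first exact: (image_vertex_kpath RP h rxy).
move=> i P; set l := (i + Posz m + Posz m + Posz m)%R.
have [z [Xz zx Vz]] := h l.
have [S SE] := pred_at_vertex l Xz.
have [|S' iS' SS'] := Vf l S; first by rewrite SE Vz.
have [z1 [l1 [Xz1 z1z ll1 z1E S'E]]] := reachable_point SS' Xz SE.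
have [z2 [t2 [q [Q [[Xz2 r2] z2z1 z2E lq [QE iQ]]]]]] :=
  indecomposable_image Xz1 S'E iS'.
have z2x k : (k < l)%R -> z2 k = x k.
  by move=> kl; rewrite z2z1 ?z1z ?zx//; lia.
have E : pred_at X l z2 = pred_at X l z.
  rewrite -z1E; apply: (pred_at_back ll1) => //.
  by move=> k ?; apply: z2z1; lia.
rewrite (image_vertexE (j := (i + Posz m)%R) RP h rxy r2)//.
  move=> PE; exists Q => //.
  apply: (reachable_pred_at (graph_codomain RP r2) _ PE QE); lia.
rewrite Vz; last by lia.
apply/esym; apply: (@pred_at_back _ _ _ l) => //; first by lia.
by move=> k ?; rewrite z2x ?zx//; lia.
Qed.

End FischerTransfer.

(** * Continuous maps and block codes *)

Definition window (T : Type) (m : nat) (x : int -> T) : set (int -> T) :=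
  [set y | forall k, (- Posz m <= k <= Posz m)%R -> y k = x k].

Lemma nbhs_window (T : choiceType) (x : full_shift T) m : nbhs x (window m x).
Proof.
have FF := nbhs_filter x.
have : nbhs x [set y : full_shift T |
    forall k, (- Posz m <= k < - Posz m + Posz (m + m).+1)%R -> y k = x k].
  elim: (m + m).+1 => [|n IHn].
    by apply: (@filterE _ (nbhs x)) => y k; lia.
  have := @filterI _ _ FF _ _ IHn (nbhs_coord x (- Posz m + Posz n)%R).
  apply: (@filterS _ _ FF) => y [/= IH yn] k ?.
  case: (ltP k (- Posz m + Posz n)%R) => kn.
    by apply: IH; lia.
  by rewrite (_ : k = (- Posz m + Posz n)%R)//; lia.
by apply: (@filterS _ _ FF) => y h k ?; apply: h; lia.
Qed.

Lemma window_nbhs (T : choiceType) (x : full_shift T) (U : set (full_shift T)) :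
  nbhs x U -> exists m, window m x `<=` U.
Proof.
rewrite nbhsE => -[O [oO Ox] OU]; apply: contrapT => /forallNP h.
suff : (~` O) x by [].
apply: closed_approx; first exact: open_closedC.
move=> n; have /existsNP[y /not_implyP[yx Uy]] := h n.
by exists y; split=> [/OU//|i ni]; apply: yx; lia.
Qed.

Section Points.
Context (S : choiceType) (X : shift_space S).
Implicit Types x : X.

Lemma shift_nbhsP x (U : set X) :
  nbhs x U <-> exists m, forall x', window m (val x) (val x') -> U x'.
Proof.
split.
  rewrite nbhsE => -[_ [[O oO <-] Ox] OU].
  have [m mO] := window_nbhs (open_nbhs_nbhs (conj oO Ox)).
  by exists m => x' /mO Ox'; exact: OU.
move=> [m mU].
have := @initial_continuous X (full_shift S) set_val x _
  (@nbhs_window S (val x) m).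
by apply: (@filterS _ _ (nbhs_filter x)) => x' /mU.
Qed.

Lemma points_compact : finite_set [set: S] -> compact (points X).
Proof.
move=> finS; apply: (subclosed_compact (@points_closed _ X)
  (@tychonoff int (fun=> discrete_topology S) (fun=> setT) _)) => //.
by move=> _; exact: finite_compact.
Qed.

Lemma iter_shift_map x n : val (iter n (@shift_map _ X) x) =
  translate (Posz n) (val x).
Proof.
elim: n => [|n IHn]; first by apply/funext => i; rewrite /translate addr0.
rewrite iterS /= IHn; apply/funext => i.
by rewrite /shift /translate; congr (_ _); lia.
Qed.

End Points.

Section Local.
Context (S T : choiceType) (X : shift_space S) (Y : shift_space T).
Implicit Types (f : X -> Y) (x : X).

Lemma local_continuous f (m : nat) : (forall x x' i,
    (forall k, (i - Posz m <= k <= i + Posz m)%R -> val x k = val x' k) ->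
    val (f x) i = val (f x') i) -> continuous f.
Proof.
move=> floc x U /= /shift_nbhsP[n nU]; apply/shift_nbhsP.
exists (n + m)%N => x' xx'; apply: nU => k kn; apply: floc => k' ?.
by apply: xx'; lia.
Qed.

(** Compactness: otherwise pairs agreeing on ever larger windows but with different images at [i]
    would cluster at a point where [f] is not continuous. *)
Lemma continuous_local f i : finite_set [set: S] -> continuous f ->
  exists m : nat, forall x x', window m (val x) (val x') ->
    val (f x) i = val (f x') i.
Proof.
move=> finS fc; apply: contrapT => /forallNP h.
have /choice[a] n : exists ab : X * X,
    window n (val ab.1) (val ab.2) /\ val (f ab.1) i <> val (f ab.2) i.
  by have /existsNP[x /existsNP[x' /not_implyP[? ?]]] := h n; exists (x, x').
move=> aP; pose F : set_system (full_shift S) :=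
  (fun n => val (a n).1 : full_shift S) @ \oo.
have FX : F (points X) by exists 0%N => // n _; exact: set_valP.
have [p [Xp clp]] := @points_compact _ X finS F _ FX.
pose x : X := SigSub (mem_set Xp).
have /shift_nbhsP[m mU] : nbhs x [set x' | val (f x') i = val (f x) i].
  have : nbhs (f x) [set y | val y i = val (f x) i].
    by apply/shift_nbhsP; exists `|i|%N => y; apply; lia.
  exact: fc.
have Fm : F ((fun n => val (a n).1) @` [set n | (m <= n)%N]).
  by exists m => // n mn; exists n.
have [_ [[n mn <-] pn]] := clp _ _ Fm (nbhs_window p m).
have [an []] := aP n.
rewrite (mU (a n).1)// (mU (a n).2)// => k ?.
by rewrite an ?pn// ; rewrite /= in mn; lia.
Qed.

(** The Curtis-Hedlund-Lyndon theorem: the window at 0 is carried to every position by the shift,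
    through preimages under its iterates when [i] is negative. *)
Lemma commute_local f : finite_set [set: S] -> continuous f ->
  (forall x, f (shift_map x) = shift_map (f x)) ->
  exists m : nat, forall x x' i,
    (forall k, (i - Posz m <= k <= i + Posz m)%R -> val x k = val x' k) ->
    val (f x) i = val (f x') i.
Proof.
move=> finS fc fs; have [m h] := continuous_local 0%R finS fc; exists m.
have fiter n x : f (iter n (@shift_map _ X) x) = iter n (@shift_map _ Y) (f x).
  by elim: n => // n IHn; rewrite !iterS fs IHn.
have fnat (n : nat) x i :
    val (f (iter n (@shift_map _ X) x)) i = val (f x) (i + Posz n)%R.
  by rewrite fiter iter_shift_map.
move=> x x' i xx'; case: (leP 0%R i) => i0.
  have [n iE] : exists n : nat, i = Posz n by exists `|i|%N; lia.
  have fE y : val (f y) i = val (f (iter n (@shift_map _ X) y)) 0%R.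
    by rewrite fnat add0r iE.
  rewrite !fE; apply: h => k ?; rewrite !iter_shift_map /translate.
  by rewrite xx'//; lia.
have [n iE] : exists n : nat, i = (- Posz n)%R by exists `|i|%N; lia.
have pre y : exists z : X, iter n (@shift_map _ X) z = y /\
    forall k, val z k = val y (k - Posz n)%R.
  have Xz : points X (translate (- Posz n) (val y)).
    by apply/points_translatez; exact: set_valP.
  exists (SigSub (mem_set Xz)); split=> //; apply: val_inj.
  by rewrite iter_shift_map; apply/funext => k; rewrite /translate /= addrK.
have [z [zE zx]] := pre x; have [z' [zE' zx']] := pre x'.
rewrite -zE -zE' !fnat iE addNr; apply: h => k ?.
by rewrite zx zx' xx'//; lia.
Qed.
End Local.

(** * Lifting a conjugacy *)

Local Notation fischer_shift X := (edge_shift (gen_left_fischer_cover X)).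

(** Gives the edge shift a finite alphabet, so that an arbitrary lift is a block code. *)
Lemma finite_fischer_edge (A : finType) (X : shift_space A) :
  finite_set (krieger_vertex X) ->
  finite_set [set: edge (gen_left_fischer_cover X)].
Proof.
move=> finX; pose f (e : edge (gen_left_fischer_cover X)) :=
  (val (src (val e)), label e, val (tgt (val e))).
have finI : finite_set (krieger_vertex X `*` [set: A] `*` krieger_vertex X).
  by do 2!apply: finite_setX => //; exact: finite_finset.
apply: sub_finite_set (finite_preimage (f := f) _ finI).
  by move=> e _; split; [split=> //|]; exact: set_valP.
move=> e e' _ _ [s a t]; apply: val_inj.
by apply: krieger_edge_inj => //; exact: vertex_inj.
Qed.

Lemma asymp_shift (A : choiceType) V x u :
  asymp (fun j => V (j + 1)%R) (shift x) (@shift A u) <-> asymp V x u.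
Proof.
split=> -[j [ux Vu]].
  exists (j + 1)%R; split.
    move=> k jk; have := ux (k - 1)%R; rewrite /shift subrK; apply; lia.
  by congr (V _ _): Vu; apply/funext => n; rewrite /past /shift; congr u; lia.
exists (j - 1)%R; split; first by move=> k ?; apply: ux; lia.
rewrite subrK; congr (V _ _): Vu.
by apply/funext => n; rewrite /past /shift; congr u; lia.
Qed.

Section PathImage.
Context (A B : choiceType) (X : shift_space A) (Y : shift_space B) (m : nat).
Context (R : (int -> A) -> (int -> B) -> Prop).
Hypothesis RP : block_graph X Y m R.
Implicit Types (e : fischer_shift X) (f : fischer_shift Y).

Definition image_of e f :=
  path_image R (path_vertex e) (path_label e) (path_vertex f) (path_label f).

Lemma image_of_ex e : finite_set (krieger_vertex Y) -> exists f, image_of e f.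
Proof.
move=> finY; have he := path_fischer_path e.
have [y rxy] := graph_total RP (kpath_points he.1).
have [f [fV fx]] := path_ex (image_vertex_fischer_path RP finY he rxy).
by exists f; rewrite /image_of fV fx; exact: (image_vertex_image RP he.1 rxy).
Qed.

(** An edge is determined by its label and its ends, at [i] and i + 1. An image vertex at [j]
    depends on the path from j - m to j + 3m, which the radius 4m + 1 covers. *)
Lemma image_of_local e e' f f' i : image_of e f -> image_of e' f' ->
  (forall k, (i - Posz (m + m + m + m).+1 <= k <=
              i + Posz (m + m + m + m).+1)%R -> val e k = val e' k) ->
  val f i = val f' i.
Proof.
move=> ef ef' ee'.
have fE j := congr1 (fun V => V j)
  (path_image_vertex RP (path_fischer_path e).1 (path_fischer_path f).1 ef).
have fE' j := congr1 (fun V => V j)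
  (path_image_vertex RP (path_fischer_path e').1 (path_fischer_path f').1 ef').
have loc j : (i <= j <= i + 1)%R -> path_vertex f j = path_vertex f' j.
  move=> ij; rewrite fE fE'.
  apply: (image_vertex_local RP (path_fischer_path e).1
    (path_fischer_path e').1 ef.1 ef'.1).
    by rewrite /path_vertex ee'//; lia.
  by move=> k ?; rewrite /path_label /label_seq ee'//; lia.
apply: path_local; [by apply: loc; lia | by apply: loc; lia |].
apply: (graph_local RP ef.1 ef'.1) => k ?.
by rewrite /path_label /label_seq ee'//; lia.
Qed.

Lemma image_of_fun e f f' : image_of e f -> image_of e f' -> f = f'.
Proof.
move=> ef ef'; apply: val_inj; apply/funext => i.
exact: (image_of_local ef ef').
Qed.

Lemma image_of_shift e f :
  (forall x y, R x y <-> R (shift x) (shift y)) ->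
  image_of e f -> image_of (shift_map e) (shift_map f).
Proof.
move=> Rs [rxy Sef]; split; first exact: (Rs (path_label e) (path_label f)).1.
move=> u v; have sh T (w : int -> T) : w = shift (translate (-1) w).
  by apply/funext => i; rewrite /shift /translate addrK.
rewrite (sh _ u) (sh _ v) => /(Rs _ _).2 ruv.
apply: (iff_trans (asymp_shift (path_vertex e) (path_label e) _)).
apply: (iff_trans (Sef _ _ ruv)); apply: iff_sym.
exact: (asymp_shift (path_vertex f) (path_label f)).
Qed.

(** The core of uniqueness: [u] labels a path [e'] right-asymptotic to [e], and a block code [h]
    sends it to a path labelled [v] that is right-asymptotic to [h e]. *)
Lemma local_asymp (h : fischer_shift X -> fischer_shift Y) (n : nat) :
  (forall e e' i, (forall k, (i - Posz n <= k <= i + Posz n)%R ->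
     val e k = val e' k) -> val (h e) i = val (h e') i) ->
  (forall e, R (path_label e) (path_label (h e))) ->
  forall e u v, R u v -> asymp (path_vertex e) (path_label e) u ->
    asymp (path_vertex (h e)) (path_label (h e)) v.
Proof.
move=> hloc hR e u v ruv Su; have [j [ux Vu]] := Su.
have [eK eF] := path_fischer_path e.
have [e' [eV ex]] :=
  path_ex (asymp_vertex_fischer_path (path_fischer_path e) Su).
have ee' k : (j <= k)%R -> val e' k = val e k.
  move=> jk; apply: path_local; rewrite ?eV ?ex.
  - by apply: (asymp_vertex_eq eK) => k' ?; apply: ux; lia.
  - by apply: (asymp_vertex_eq eK) => k' ?; apply: ux; lia.
  - exact: ux.
have hee' k : (j + Posz n <= k)%R -> val (h e') k = val (h e) k.
  by move=> jk; apply: hloc => k' ?; apply: ee'; lia.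
have vE : path_label (h e') = v.
  by apply: (graph_fun RP (x := u)) => //; rewrite -ex; exact: hR.
exists (j + Posz n)%R; split.
  by move=> k jk; rewrite -vE /path_label /label_seq hee'.
rewrite -vE (_ : path_vertex (h e) _ = path_vertex (h e') (j + Posz n)%R).
  exact: kpath_self (path_fischer_path (h e')).1.
by rewrite /path_vertex hee'.
Qed.

End PathImage.

(** * Conjugacies as block graphs *)

Definition map_graph (A B : choiceType) (X : shift_space A) (Y : shift_space B)
    (phi : X -> Y) (x : int -> A) (y : int -> B) : Prop :=
  exists x', val x' = x /\ val (phi x') = y.

Lemma cancel_commute (S T : Type) (f : S -> T) (g : T -> S) a b :
  cancel f g -> cancel g f -> (forall x, f (a x) = b (f x)) ->
  forall y, g (b y) = a (g y).
Proof. by move=> fK gK fab y; rewrite -[y in LHS]gK -fab fK. Qed.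

Lemma conjugacy_local (S T : choiceType) (X : shift_space S)
    (Y : shift_space T) (f : X -> Y) : finite_set [set: S] -> conjugacy f ->
  exists m : nat, forall x x' i,
    (forall k, (i - Posz m <= k <= i + Posz m)%R -> val x k = val x' k) ->
    val (f x) i = val (f x') i.
Proof. by move=> finS [[fc _] fs]; exact: commute_local. Qed.

Lemma conjugacy_inverse (S T : choiceType) (X : shift_space S)
    (Y : shift_space T) (f : X -> Y) : conjugacy f ->
  exists g : Y -> X, [/\ conjugacy g, cancel f g & cancel g f].
Proof.
move=> [[fc [g [gc fK gK]]] fs]; exists g; split=> //.
split; first by split=> //; exists f.
exact: cancel_commute fs.
Qed.

Lemma conjugacy_graph (A B : finType) (X : shift_space A) (Y : shift_space B)
    (phi : X -> Y) : conjugacy phi ->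
  exists m, block_graph X Y m (map_graph phi).
Proof.
move=> cphi; have [g [cg phiK gK]] := conjugacy_inverse cphi.
have [m1 h1] := conjugacy_local (@finite_finset A _) cphi.
have [m2 h2] := conjugacy_local (@finite_finset B _) cg.
exists (m1 + m2)%N; split.
- by move=> _ y [x [<- _]]; exact: set_valP.
- by move=> _ _ [x [_ <-]]; exact: set_valP.
- move=> x Xx; pose x' : X := SigSub (mem_set Xx).
  by exists (val (phi x')); exists x'.
- move=> y Yy; pose y' : Y := SigSub (mem_set Yy).
  by exists (val (g y')); exists (g y'); rewrite gK.
- move=> _ _ _ _ i [x [<- <-]] [x' [<- <-]] xx'.
  by apply: h1 => k ?; apply: xx'; lia.
- move=> _ _ _ _ i [x [<- <-]] [x' [<- <-]] xx'.
  rewrite -(phiK x) -(phiK x').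
  by apply: h2 => k ?; apply: xx'; lia.
Qed.

Lemma map_graph_shift (A B : choiceType) (X : shift_space A)
    (Y : shift_space B) (phi : X -> Y) : conjugacy phi ->
  forall x y, map_graph phi x y <-> map_graph phi (shift x) (shift y).
Proof.
move=> [_ phis] x y; split=> [[x' [<- <-]]|[x' [xE yE]]].
  by exists (shift_map x'); rewrite phis.
have Xx : points X x by apply/points_shift; rewrite -xE; exact: set_valP.
pose x0 : X := SigSub (mem_set Xx); exists x0; split=> //.
have x0E : shift_map x0 = x' by exact: val_inj.
have : shift (val (phi x0)) = shift y by rewrite -yE -x0E phis.
move=> E; apply/funext => i; have := congr1 (fun w => w (i - 1)%R) E.
by rewrite /shift subrK.
Qed.

Lemma covering_map_graph (A B : choiceType) (X : shift_space A)
    (Y : shift_space B) (phi : X -> Y) e f :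
  covering_map f = phi (covering_map e) <->
  map_graph phi (path_label e) (path_label f).
Proof.
split=> [E|[x [xE yE]]]; first by exists (covering_map e); rewrite -E.
have <- : x = covering_map e by exact: val_inj.
by apply: val_inj; rewrite yE.
Qed.

Theorem theorem3p12 (A B : finType) (X : shift_space A) (Y : shift_space B)
    (phi : X -> Y) :
  sofic X -> sofic Y -> conjugacy phi ->
  exists! psi : edge_shift (gen_left_fischer_cover X) ->
                edge_shift (gen_left_fischer_cover Y),
    conjugacy psi /\
    forall e, covering_map (psi e) = phi (covering_map e).
Proof.
move=> /finite_krieger_vertex finX /finite_krieger_vertex finY cphi.
have [m RP] := conjugacy_graph cphi; have RPf := block_graph_flip RP.
have Rs := map_graph_shift cphi.
set R := map_graph phi in RP RPf Rs.
have flipE (e : fischer_shift X) (f : fischer_shift Y) :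
    image_of R e f <-> image_of (fun y x => R x y) f e.
  by split=> -[r S]; split=> // u v ruv; apply: iff_sym; exact: S.
have /choice[psi psiP] (e : fischer_shift X) :
    exists f : fischer_shift Y, image_of R e f.
  exact: (image_of_ex RP e finY).
have /choice[psi' psiP'] (f : fischer_shift Y) :
    exists e : fischer_shift X, image_of R e f.
  by have [e fe] := image_of_ex RPf f finX; exists e; apply/flipE.
have psiK : cancel psi psi'.
  by move=> e; apply: (image_of_fun RPf (e := psi e)); apply/flipE.
exists psi; split.
  split; last by move=> e; apply/covering_map_graph; exact: (psiP e).1.
  split; last first.
    move=> e; apply: (image_of_fun RP (psiP _)).
    exact: image_of_shift.
  split; first by apply: local_continuous => e e' i; exact: (image_of_local RP).
  exists psi'; split=> //.
  - apply: local_continuous => f f' i.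
    by apply: (image_of_local RPf); exact/flipE.
  - by move=> f; apply: (image_of_fun RP (psiP _) (psiP' _)).
move=> h [ch hphi]; apply/funext => e.
apply: (image_of_fun RP (psiP e)).
(* Applying [local_asymp] to [h] and to its inverse gives both inclusions between the asymptotic
   sets, so [h e] is an image of [e], and images are unique. *)
have [g [cg hK gK]] := conjugacy_inverse ch.
have [n hloc] := conjugacy_local (finite_fischer_edge finX) ch.
have [n' gloc] := conjugacy_local (finite_fischer_edge finY) cg.
have hR e' : R (path_label e') (path_label (h e')).
  by apply/covering_map_graph; exact: hphi.
split=> // u v ruv; split; first exact: (local_asymp RP hloc hR).
have gR f : R (path_label (g f)) (path_label f) by rewrite -{2}[f]gK.
by move=> /(local_asymp RPf gloc gR ruv); rewrite hK.
Qed.
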